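(* Let $s,T\in\mathbb{N}$ with $s,T\ge 1$, let $\mathcal{D}_{T:0}$ be the distribution of the noise sequence $w_{T:0}$ on $\mathbb{W}^{T+1}$, and let $\mathbb{S}=\{w^i_{T:0}\}_{i=1}^{s}\sim\mathcal{D}_{T:0}^{s}$ be a dataset of $s$ i.i.d. noise sequences drawn from $\mathcal{D}_{T:0}$. Let $\mathcal{P}$ be a (prior) probability distribution on the controller parameter set $\Theta\subset\mathbb{R}^d$ that is chosen independently of $\mathbb{S}$. Let $L(\theta,w_{T:0})$ be the finite-horizon cost, and assume that there is $C>0$ such that $L(\theta,w_{T:0})\in[0,C)$ for all $\theta\in\Theta$ and all $w_{T:0}\in\mathbb{W}^{T+1}$. Then for every $\lambda>0$, every $\delta\in(0,1)$, and every (posterior) probability distribution $\mathcal{Q}$ on $\Theta$, which may depend on $\mathbb{S}$ and is absolutely continuous with respect to $\mathcal{P}$, the inequality $$\mathcal{L}(\theta,\mathcal{D}_{T:0})\;\le\;\hat{\mathcal{L}}(\theta,\mathbb{S})+\frac{1}{\lambda}\Bigl(\ln\frac{d\mathcal{Q}}{d\mathcal{P}}(\theta)+\ln\frac{1}{\delta}\Bigr)+\frac{\lambda C^2}{8s}$$ holds with probability at least $1-\delta$ over simultaneously sampling $\mathbb{S}\sim\mathcal{D}_{T:0}^{s}$ and (given $\mathbb{S}$) $\theta\sim\mathcal{Q}$.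
   Context: System: $x_0=\bar{x}+w_0$ and $x_t=f_t(x_{t-1:0},u_{t-1:0})+w_t$ for $t=1,2,\dots$, where $\bar{x}\in\mathbb{X}\subset\mathbb{R}^n$ is the nominal initial state, $x_t\in\mathbb{X}\subset\mathbb{R}^n$ is the state, $u_t\in\mathbb{U}\subset\mathbb{R}^m$ is the input, and $w_t\in\mathbb{W}\subset\mathbb{R}^n$ is process noise with $w_t\sim\mathcal{D}_t$. The notation $x_{t:0}$ means $(x_0,\dots,x_t)$. The controller is $u_t=-K^\theta_t(x_{t:0})$, $t=0,1,\dots$, with parameter $\theta\in\Theta\subset\mathbb{R}^d$. For each $\theta$, the closed loop determines the state and input trajectories uniquely from the noise, $(x_{t:0},u_{t:0})=r^\theta_{t:0}(w_{t:0})$. $\mathcal{D}_{T:0}=(\mathcal{D}_0,\dots,\mathcal{D}_T)$ denotes the probability distribution on $\mathbb{W}^{T+1}$ of the noise sequence $w_{T:0}=(w_0,\dots,w_T)$, where $w_t\sim\mathcal{D}_t$. $\mathcal{D}_{T:0}^s$ denotes the law of $s$ i.i.d. such sequences. Stage cost: $l:\mathbb{X}\times\mathbb{U}\to[0,\infty)$, piecewise differentiable. Finite-horizon cost: $L(\theta,w_{T:0})=\frac1T\sum_{t=0}^{T}l(x_t,u_t)$, where $(x_{T:0},u_{T:0})=r^\theta_{T:0}(w_{T:0})$. True cost: $\mathcal{L}(\theta,\mathcal{D}_{T:0})=\mathbb{E}_{w_{T:0}\sim\mathcal{D}_{T:0}}L(\theta,w_{T:0})$. Empirical cost: $\hat{\mathcal{L}}(\theta,\mathbb{S})=\frac1s\sum_{i=1}^sL(\theta,w^i_{T:0})$.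 $d\mathcal{Q}/d\mathcal{P}$ is the Radon–Nikodym derivative. All maps are assumed measurable as needed: $L$ is jointly measurable in $(\theta,w_{T:0})$, $\mathbb{S}\mapsto\mathcal{Q}$ is a Markov kernel from datasets to $\Theta$, and $(\theta,\mathbb{S})\mapsto\frac{d\mathcal{Q}}{d\mathcal{P}}(\theta)$ is jointly measurable. *)

(* Defs.v *)
From HB Require Import structures.
From mathcomp Require Import all_boot all_order all_algebra.
From mathcomp Require Import all_classical all_reals all_analysis measurable_realfun.

Set Implicit Arguments.
Unset Strict Implicit.
Unset Printing Implicit Defensive.

Import Order.TTheory GRing.Theory Num.Theory.
Import numFieldNormedType.Exports.

Local Open Scope classical_set_scope.
Local Open Scope ring_scope.

(** A nonempty subset of a topological space, as a type carrying the Borel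
    sigma-algebra of its subspace topology. The set itself need not be
    measurable; nonemptiness is only there because measurable types are
    pointed. *)
Definition borel_subset {V : topologicalType} (A : set V) (A0 : A !=set0) :
  Type := set_type A.

Section borel_subset_instances.
Context (V : topologicalType) (A : set V) (A0 : A !=set0).

Let a0 : borel_subset A0 :=
  exist (fun x => x \in A) (sval (cid A0)) (mem_set (svalP (cid A0))).

HB.instance Definition _ := Choice.on (borel_subset A0).
HB.instance Definition _ := isPointed.Build (borel_subset A0) a0.
HB.instance Definition _ := Measurable.copy (borel_subset A0)
  (g_sigma_algebraType (@open (set_type A) : set (set (borel_subset A0)))).

End borel_subset_instances.

Definition point_of {V : topologicalType} {A : set V} {A0 : A !=set0}
  (x : borel_subset A0) : V := \val (x : set_type A).

(** [D^n], the law of [n] independent draws from [D], obtained by iterating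
    the binary product measure. *)
Section iid_law.
Context d (Z : measurableType d) (R : realType).

Definition tuple_cons n (p : Z * n.-tuple Z) : n.+1.-tuple Z :=
  [tuple of p.1 :: p.2].

Lemma measurable_tuple_cons n : measurable_fun setT (@tuple_cons n).
Proof. exact: measurable_cons. Qed.

HB.instance Definition _ n :=
  isMeasurableFun.Build _ _ _ _ (@tuple_cons n) (@measurable_tuple_cons n).

Fixpoint iid_law (D : probability Z R) n : probability (n.-tuple Z) R :=
  if n is n'.+1 then distribution (D \x iid_law D n')%E (@tuple_cons n')
  else dirac [tuple].

Lemma iid_law_box (D : probability Z R) n (A : 'I_n -> set Z) :
  (forall i, measurable (A i)) ->
  iid_law D n [set S | forall i, A i (tnth S i)] = (\prod_(i < n) D (A i))%E.
Proof.
elim: n A => [|n IH] A mA.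
  by rewrite big_ord0 /= diracE mem_set//= => -[].
rewrite big_ord_recl -(IH (fun i => A (lift ord0 i)))// /= /distribution /pushforward.
rewrite (_ : _ @^-1` _ = A ord0 `*` [set S | forall i : 'I_n, A (lift ord0 i) (tnth S i)]); last first.
  apply/seteqP; split=> [[z S] /= h|[z S] /= [h1 h2] i].
    split; first exact: (h ord0).
    by move=> i; have := h (lift ord0 i); rewrite /tuple_cons tnthS.
  by case: (unliftP ord0 i) => [j ->|->] //; rewrite /tuple_cons tnthS.
rewrite product_measure1E//.
rewrite (_ : mkset _ = \bigcap_(i in [set: 'I_n]) ((fun S => tnth S i) @^-1` A (lift ord0 i))).
  apply: fin_bigcap_measurable => // i _; rewrite -[X in measurable X]setTI.
  exact: measurable_tnth.
by apply/seteqP; split=> [S /= h i _|S /= h i]; [exact: h | exact: (h i I)].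
Qed.

End iid_law.

(** Joint law of [(S, theta)] when [S ~ mu] and, given [S], [theta ~ Q S]. *)
Definition joint_law d d' (X : measurableType d) (Y : measurableType d')
    (R : realType) (mu : probability X R) (Q : X -> probability Y R) :
    set (X * Y) -> \bar R :=
  kproduct_snd (fun _ : unit => mu) (fun S => Q S) tt.

Definition locally_closed {V : topologicalType} (A : set V) :=
  exists O F : set V, [/\ open O, closed F & A = O `&` F].

(** Around every point of [A], finitely many locally closed pieces suffice to
    cover [A], and on each of them [g] agrees with a function differentiable
    at every point of that piece. Jumps between pieces are allowed. *)
Definition piecewise_differentiable {R : realType} {V : normedModType R}
    (A : set V) (g : V -> R) :=
  forall z, A z -> exists (k : nat) (P : 'I_k -> set V) (h : 'I_k -> V -> R),
    [/\ forall i, locally_closed (P i),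
        forall i y, A y -> P i y -> differentiable (h i) y /\ g y = h i y
      & \forall y \near z, A y -> exists i, P i y].

Section closed_loop.
Context (R : realType) (n m d : nat).
Variable f : forall t, t.-tuple 'rV[R]_n -> t.-tuple 'rV[R]_m -> 'rV[R]_n.
Variable K : 'rV[R]_d -> forall t, t.+1.-tuple 'rV[R]_n -> 'rV[R]_m.
Variable xbar : 'rV[R]_n.

(** [closed_loop theta w t] is [((x_0, ..., x_t), (u_0, ..., u_t))]. It
    depends on [w] only through [w 0, ..., w t]. The value of [f] at [t = 0] is
    never used. *)
Fixpoint closed_loop (theta : 'rV[R]_d) (w : nat -> 'rV[R]_n) (t : nat) :
    t.+1.-tuple 'rV[R]_n * t.+1.-tuple 'rV[R]_m :=
  if t is t'.+1 then
    let xu := closed_loop theta w t' in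
    let x := [tuple of rcons xu.1 (f xu.1 xu.2 + w t'.+1)] in
    (x, [tuple of rcons xu.2 (- K theta x)])
  else
    let x := [tuple xbar + w 0%N] in (x, [tuple - K theta x]).

Definition finite_horizon_cost (l : 'rV[R]_n -> 'rV[R]_m -> R) (T : nat)
    (theta : 'rV[R]_d) (w : nat -> 'rV[R]_n) : R :=
  let xu := closed_loop theta w T in
  T%:R^-1 * \sum_(t < T.+1) l (tnth xu.1 t) (tnth xu.2 t).

End closed_loop.

Notation noise_seq W0 T := (T.+1.-tuple (borel_subset W0)).
Notation dataset W0 T s := (s.-tuple (noise_seq W0 T)).

(** Junk beyond the horizon [T], where the closed loop never looks. *)
Definition noise_path {R : realType} {n T : nat} {W : set 'rV[R]_n}
    {W0 : W !=set0} (w : noise_seq W0 T) : nat -> 'rV[R]_n :=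
  fun t => point_of (tnth w (inord t)).

Definition true_cost d (Z : measurableType d) (R : realType) (Y : Type)
    (L : Y -> Z -> R) (D : probability Z R) (theta : Y) : \bar R :=
  'E_D[L theta].

Definition empirical_cost (R : realType) (Y Z : Type) (L : Y -> Z -> R)
    (s : nat) (S : s.-tuple Z) (theta : Y) : R :=
  s%:R^-1 * \sum_(i < s) L theta (tnth S i).

(* Main.v *)
(** For fixed [theta], Hoeffding's lemma and independence give
    [E_S exp (lambda (cost - empirical cost) - lambda^2 C^2 / (8 s)) <= 1].
    Call this integrand [A S theta]. The claimed bound fails exactly where
    [dQ/dP < delta * A S theta], so, given [S], it fails with [Q]-probability
    at most [delta * int A S dP]; by Tonelli this averages to at most [delta]
    over [S]. *)

Require Import Defs.
From mathcomp Require Import all_boot all_order all_algebra.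
From mathcomp Require Import all_classical all_reals all_analysis measurable_realfun.
From mathcomp Require Import ring lra.

Set Implicit Arguments.
Unset Strict Implicit.
Unset Printing Implicit Defensive.

Import Order.TTheory GRing.Theory Num.Theory.
Import numFieldNormedType.Exports.

Local Open Scope classical_set_scope.
Local Open Scope ring_scope.

(** * Real-variable inequalities behind Hoeffding's lemma *)

Lemma is_derive_ge0_homo (R : realType) (F dF : R -> R) (a : R) :
  (forall x, is_derive x (1 : R) F (dF x)) -> (forall x, a <= x -> 0 <= dF x) ->
  forall x, a <= x -> F a <= F x.
Proof.
move=> FdF dF_ge0 x ax.
apply: (@ger0_derive1_ndecry _ F a) => //.
- by move=> y; rewrite in_itv/= andbT => ay; rewrite derive1E derive_val dF_ge0// ltW.
- apply: continuous_subspaceT => y; apply: differentiable_continuous.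
  exact/derivable1_diffP.
Qed.

(** The moment generating function of a Bernoulli variable of mean [q]. The gap [F] between the
    logarithms of the two sides vanishes at 0, as does its derivative [G], and [G] is nondecreasing;
    so [G], and then [F], is nonnegative on the half-line. *)
Lemma hoeffding_two_point (R : realType) (q h : R) : 0 <= q <= 1 -> 0 <= h ->
  q * expR h + (1 - q) <= expR (q * h + h ^+ 2 / 8).
Proof.
move=> /andP[q0 q1] h0.
pose psi x : R := q * expR x + (1 - q).
have psi_gt0 x : 0 < psi x.
  have := expR_gt0 x; rewrite /psi => ex.
  have [->|qn0] := eqVneq q 0; first by lra.
  have : 0 < q * expR x by rewrite mulr_gt0// lt_neqAle eq_sym qn0.
  lra.
(* The derivative of [ln (psi x)] is [q * expR x / psi x], written here as [1 - (1 - q) / psi x] so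
   that only the inverse depends on [psi]. *)
pose G (x : R) : R := q + x / 4 - 1 + (1 - q) * (psi x)^-1.
pose F (x : R) : R := q * x + x ^+ 2 / 8 - ln (psi x).
have dpsi x : is_derive x (1 : R) psi (q * expR x).
  by apply: is_derive_eq; rewrite /GRing.scale/=; ring.
have dG x : is_derive x (1 : R) G (4^-1 - (1 - q) * (q * expR x) / psi x ^+ 2).
  have dV := is_deriveV (lt0r_neq0 (psi_gt0 x)) (dpsi x).
  apply: is_derive_eq; rewrite /GRing.scale/=; ring.
have dF x : is_derive x (1 : R) F (G x).
  have dln := @is_derive1_comp _ _ _ _ _ _ (is_derive1_ln (psi_gt0 x)) (dpsi x).
  apply: is_derive_eq; rewrite /GRing.scale/= /G.
  have := lt0r_neq0 (psi_gt0 x); rewrite /psi => psi0; field.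
  by [].
have G_ge0 x : 0 <= x -> 0 <= G x.
  have G0 : G 0 = 0 by rewrite /G /psi expR0 mulr1 subrKC invr1; ring.
  move=> x0; rewrite -G0; apply: (is_derive_ge0_homo dG) x0 => {}x _.
  rewrite subr_ge0 ler_pdivrMr ?exprn_gt0// /psi.
  (* This is [4 a b <= (a + b)^2] with [a = q * expR x] and [b = 1 - q]; hence the constant 1/4, and
     1/8 after integrating. *)
  have := sqr_ge0 (q * expR x - (1 - q)); nra.
have : F 0 <= F h by apply: (is_derive_ge0_homo dF).
rewrite {1}/F {1}/psi expR0 mulr1 subrKC ln1 mulr0 expr0n/= mul0r addr0 subr0.
rewrite /F subr_ge0 => lnpsi.
by move: lnpsi; rewrite -ler_expR lnK// posrE.
Qed.

(** Convexity of the exponential between [- (t * C)] and 0, with weight [x / C] on the first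
    endpoint. *)
Lemma expR_chord (R : realType) (C x t : R) : 0 < C -> 0 <= x <= C ->
  expR (- (t * x)) <= (1 - x / C) + x / C * expR (- (t * C)).
Proof.
move=> C0 /andP[x0 xC].
have u0 : 0 <= x / C by rewrite divr_ge0// ltW.
have u1 : x / C <= 1 by rewrite ler_pdivrMr// mul1r.
have := convex_expR (Itv01 u0 u1) (- (t * C)) 0.
rewrite !convRE/= expR0 /unstable.onem mulr0 addr0 mulr1 [_ + (1 - _)]addrC.
by rewrite (_ : x / C * - (t * C) = - (t * x))//; field; rewrite gt_eqF.
Qed.

(** * Hoeffding's moment bound for one draw, and independence of several draws *)

Section hoeffding.
Context d (Z : measurableType d) (R : realType) (D : probability Z R).

Lemma bounded_integrable_cc (X : Z -> R) (C : R) : measurable_fun setT X ->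
  (forall z, 0 <= X z <= C) -> D.-integrable setT (EFin \o X).
Proof.
move=> mX XC; apply: (le_integrable measurableT _ _
  (finite_measure_integrable_cst D C measurableT)).
- exact/measurable_EFinP.
- move=> z _ /=; have /andP[X0 XleC] := XC z.
  by rewrite lee_fin !ger0_norm// (le_trans X0).
Qed.

Lemma bounded_expectation (X : Z -> R) (C : R) : measurable_fun setT X ->
  (forall z, 0 <= X z <= C) ->
  exists2 mu : R, 'E_D[X]%E = mu%:E & 0 <= mu <= C.
Proof.
move=> mX XC; have iX := bounded_integrable_cc mX XC.
have EX_fin : 'E_D[X]%E \is a fin_num.
  by rewrite unlock integrable_fin_num.
have C0 : 0 <= C by have /andP[/le_trans] := XC point; apply.
exists (fine 'E_D[X]%E); first by rewrite fineK.
rewrite -!lee_fin fineK//; apply/andP; split.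
  by apply: expectation_ge0 => z; have /andP[] := XC z.
rewrite -(expectation_cst D C) unlock; apply: ge0_le_integral => //.
- by move=> z _; rewrite lee_fin; have /andP[] := XC z.
- exact/measurable_EFinP.
- exact/measurable_EFinP.
- by move=> z _ /=; rewrite lee_fin; have /andP[] := XC z.
Qed.

(** The chord bound is affine in [X], so its integral depends on [X] only through [mu]. It is the
    value for a variable on the two points 0 and [C] with mean [mu], which the two-point inequality
    controls at [h = t * C]. *)
Lemma hoeffding_mmt_gen (X : Z -> R) (C mu t : R) : 0 < C -> 0 <= t ->
  measurable_fun setT X -> (forall z, 0 <= X z <= C) -> 'E_D[X]%E = mu%:E ->
  (\int[D]_z (expR (t * (mu - X z)))%:E <= (expR (t ^+ 2 * C ^+ 2 / 8))%:E)%E.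
Proof.
move=> C0 t0 mX XC EX.
have iX := bounded_integrable_cc mX XC.
have /andP[mu0 muC] : 0 <= mu <= C.
  by have [nu] := bounded_expectation mX XC; rewrite EX => -[->].
pose e : R := expR (t * mu).
(* Slope of the chord of [expR (- (t * x))] over the interval from 0 to [C]. *)
pose k : R := (expR (- (t * C)) - 1) / C.
have chord z : expR (t * (mu - X z)) <= e + e * k * X z.
  rewrite mulrBr expRD (_ : e + _ = e * ((1 - X z / C) + X z / C * expR (- (t * C)))).
    by rewrite ler_wpM2l ?expR_ge0// expR_chord.
  by rewrite /k; field; rewrite gt_eqF.
have ikX : D.-integrable setT (fun z => ((e * k)%:E * (X z)%:E)%E).
  exact: integrableZl.
apply: (@le_trans _ _ (\int[D]_z (e%:E + (e * k)%:E * (X z)%:E))%E).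
  apply: ge0_le_integral => //.
  - apply/measurable_EFinP; apply: measurableT_comp => //.
    by apply: measurable_funM => //; apply: measurable_funB.
  - apply: emeasurable_funD => //; apply: emeasurable_funM => //.
    exact/measurable_EFinP.
  - by move=> z _; rewrite lee_fin.
rewrite integralD//; last exact: (finite_measure_integrable_cst D e measurableT).
rewrite integral_cst//= probability_setT mule1 integralZl//.
move: EX; rewrite unlock => ->; rewrite lee_fin.
(* The mass that the two-point variable puts at 0. *)
have q01 : 0 <= 1 - mu / C <= 1.
  by rewrite subr_ge0 gerBl divr_ge0 ?(ltW C0)// ler_pdivrMr// mul1r muC.
have := hoeffding_two_point q01 (mulr_ge0 t0 (ltW C0)).
set q := 1 - mu / C => hq.
have -> : e + e * k * mu = expR (- (q * (t * C))) * (q * expR (t * C) + (1 - q)).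
  have -> : - (q * (t * C)) = t * mu - t * C by rewrite /q; field; rewrite gt_eqF.
  rewrite expRD -/e /k expRN /q; field.
  by rewrite !gt_eqF// expR_gt0.
apply: (le_trans (ler_wpM2l (expR_ge0 _) hq)).
by rewrite -expRD ler_expR addKr exprMn.
Qed.

(** Independence, by induction on [n]: Tonelli separates the first draw from the others.
    Nonnegativity of [phi] stands in for integrability, so both sides may be infinite. *)
Lemma integral_iid_law_prod n (phi : Z -> R) : measurable_fun setT phi ->
  (forall z, 0 <= phi z) ->
  (\int[iid_law D n]_S (\prod_(i < n) phi (tnth S i))%:E =
   (\int[D]_z (phi z)%:E) ^+ n)%E.
Proof.
move=> mphi phi0.
have mprod m : measurable_fun setT
    (fun S : m.-tuple Z => (\prod_(i < m) phi (tnth S i))%:E).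
  apply/measurable_EFinP; apply: measurable_prod => i _.
  by apply: measurableT_comp => //; exact: measurable_tnth.
have prod0 m (S : m.-tuple Z) : (0 <= (\prod_(i < m) phi (tnth S i))%:E)%E.
  by rewrite lee_fin prodr_ge0.
elim: n => [|n IH].
  under eq_integral do rewrite big_ord0.
  by rewrite integral_cst// [X in (_ * X)%E](probability_setT (iid_law D 0)) mule1.
have -> : (\int[iid_law D n.+1]_S (\prod_(i < n.+1) phi (tnth S i))%:E =
    \int[D \x iid_law D n]_p
      ((phi p.1)%:E * (\prod_(i < n) phi (tnth p.2 i))%:E))%E.
  (* Change of variables: [iid_law D n.+1] is the image of the product measure under
     [tuple_cons]. *)
  transitivity (\int[D \x iid_law D n]_p
      (\prod_(i < n.+1) phi (tnth (tuple_cons p) i))%:E)%E.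
    exact: (@ge0_integral_distribution _ _ _ _ _ (D \x iid_law D n)%E
      (@tuple_cons _ Z n) _ (mprod n.+1) (prod0 n.+1)).
  apply: eq_integral => p _; rewrite big_ord_recl -EFinM; congr (phi _ * _)%:E.
  by apply: eq_bigr => i _; rewrite tnthS.
have mphi1 : measurable_fun setT (fun p : Z * n.-tuple Z => (phi p.1)%:E).
  by apply/measurable_EFinP; exact: measurableT_comp.
rewrite fubini_tonelli1; last 2 first.
- by apply: emeasurable_funM => //; exact: (measurableT_comp (mprod n)).
- by move=> p; apply: mule_ge0; [rewrite lee_fin | exact: prod0].
rewrite expeS -ge0_integralZr//.
- apply: eq_integral => z _; rewrite -IH /fubini_F/=.
  rewrite -ge0_integralZl//; [exact: mprod | by move=> S _; exact: prod0 |].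
  by rewrite lee_fin.
- exact/measurable_EFinP.
- by move=> z _; rewrite lee_fin.
- by rewrite expe_ge0// integral_ge0// => z _; rewrite lee_fin.
Qed.

End hoeffding.

(** * Disintegration of the joint law and change of measure *)

(** Lets an event be estimated one dataset at a time. *)
Lemma joint_lawE d d' (X : measurableType d) (Y : measurableType d')
    (R : realType) (mu : probability X R) (Q : X -> probability Y R)
    (A : set (X * Y)) : measurable A ->
  joint_law mu Q A = (\int[mu]_x Q x (xsection A x))%E.
Proof.
move=> mA; apply: eq_integral => x _.
transitivity (\int[Q x]_y (\1_(xsection A x) y)%:E)%E.
  by apply: eq_integral => y _; rewrite !indicE mem_xsection.
by rewrite integral_indic ?setIT//; exact: measurable_xsection.
Qed.

(** [Q B] is the integral of the density over [B], where [a] dominates it; passing from [B] to the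
    whole space only increases the integral of [a >= 0]. Any measurable version [g] of the density
    may be used. *)
Lemma Radon_Nikodym_le_integral d (Y : measurableType d) (R : realType)
    (P Q : probability Y R) (g a : Y -> \bar R) (B : set Y) :
  Q `<< P -> measurable_fun setT g -> measurable_fun setT a ->
  {ae P, forall y, g y = Radon_Nikodym (charge_of_finite_measure Q) P y} ->
  measurable B -> (forall y, 0 <= a y)%E -> (forall y, B y -> g y <= a y)%E ->
  (Q B <= \int[P]_y a y)%E.
Proof.
move=> QP mg ma gE mB a0 ga.
have nuP : charge_of_finite_measure Q `<< P by [].
have -> : Q B = (\int[P]_(y in B) g y)%E.
  rewrite -[Q B]/(charge_of_finite_measure Q B) (Radon_Nikodym_integral nuP mB).
  apply: ae_eq_integral => //.
  - apply: measurable_funTS; apply: (measurable_int P).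
    exact: Radon_Nikodym_integrable.
  - exact: measurable_funTS.
  - by apply: filterS gE => y /= ->.
(* [g] need not be nonnegative pointwise, only its positive part matters. *)
rewrite integralE (@le_trans _ _ (\int[P]_(y in B) (g ^\+)%E y)%E)//.
  by rewrite geeDl// oppe_le0 integral_ge0.
rewrite (@le_trans _ _ (\int[P]_(y in B) a y)%E)//.
  apply: ge0_le_integral => //.
  - by apply: measurable_funepos; exact: measurable_funTS.
  - exact: measurable_funTS.
  - by move=> y By; rewrite funeposE ge_max ga// a0.
exact: ge0_subset_integral.
Qed.

(** * The PAC-Bayes bound for an abstract bounded cost *)

Section pac_bayes.
Context d d' (Z : measurableType d) (Y : measurableType d') (R : realType).
Variables (D : probability Z R) (L : Y -> Z -> R) (C : R) (s : nat).
Hypothesis mL : measurable_fun setT (fun p : Y * Z => L p.1 p.2).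
Hypothesis C_gt0 : 0 < C.
Hypothesis LC : forall y z, 0 <= L y z <= C.
Hypothesis s_gt0 : (0 < s)%N.

(** [fine] loses nothing here: a cost with values in [[0, C]] has finite expectation. *)
Definition mean_cost y : R := fine (true_cost L D y).

Let measurable_L y : measurable_fun setT (L y).
Proof. exact: (measurableT_comp mL (measurable_pair1 y)). Qed.

Let meanE y : true_cost L D y = (mean_cost y)%:E.
Proof.
rewrite /mean_cost fineK// /true_cost.
by have [? ->] := bounded_expectation D (measurable_L y) (LC y).
Qed.

Let measurable_mean : measurable_fun setT mean_cost.
Proof.
apply: measurableT_comp => //; rewrite /true_cost unlock.
apply: (@measurable_fun_fubini_tonelli_F _ _ _ _ _ _ (fun p => (L p.1 p.2)%:E)).
  exact/measurable_EFinP.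
by move=> p; rewrite lee_fin; have /andP[] := LC p.1 p.2.
Qed.

Let measurable_empirical :
  measurable_fun setT (fun p : Y * s.-tuple Z => empirical_cost L p.2 p.1).
Proof.
apply: measurable_funM => //; apply: measurable_sum => i.
apply: (measurableT_comp (g := fun p : Y * s.-tuple Z => (p.1, tnth p.2 i)) mL).
apply: measurable_fun_pair => //.
apply: (measurableT_comp (measurable_tnth i)); exact: measurable_snd.
Qed.

Variable lambda : R.
Hypothesis lambda_gt0 : 0 < lambda.

(** The integrand [A S theta] of the overview. The subtracted term is the sum of [s] Hoeffding
    exponents [t ^+ 2 * C ^+ 2 / 8] at [t = lambda / s]. *)
Definition exp_excess (S : s.-tuple Z) y : R :=
  expR (lambda * (mean_cost y - empirical_cost L S y)
        - lambda ^+ 2 * C ^+ 2 / (8 * s%:R)).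

Let measurable_excess :
  measurable_fun setT (fun p : Y * s.-tuple Z => exp_excess p.2 p.1).
Proof.
apply: measurableT_comp => //; apply: measurable_funB => //.
apply: measurable_funM => //; apply: measurable_funB => //.
exact: measurableT_comp.
Qed.

(** The excess factors into one term [phi] per draw, and each factor has integral at most 1 by
    Hoeffding's bound. *)
Lemma integral_excess_le1 y : (\int[iid_law D s]_S (exp_excess S y)%:E <= 1)%E.
Proof.
pose t := lambda / s%:R.
pose phi z : R := expR (t * (mean_cost y - L y z) - t ^+ 2 * C ^+ 2 / 8).
have s_neq0 : s%:R != 0 :> R by rewrite pnatr_eq0 -lt0n.
have excessE S : exp_excess S y = \prod_(i < s) phi (tnth S i).
  rewrite /phi -expR_sum sumrB sumr_const card_ord -mulr_sumr sumrB.
  rewrite sumr_const card_ord -(mulr_natr (mean_cost y)) -(mulr_natr (_ / 8)).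
  rewrite /exp_excess /empirical_cost /t; congr expR; field.
  by rewrite s_neq0.
have mphi : measurable_fun setT phi.
  apply: measurableT_comp => //; apply: measurable_funB => //.
  by apply: measurable_funM => //; apply: measurable_funB.
under eq_integral do rewrite excessE.
rewrite integral_iid_law_prod//; last by move=> z; exact: expR_ge0.
have int_phi : (\int[D]_z (phi z)%:E <= 1)%E.
  under eq_integral do rewrite /phi expRD EFinM.
  rewrite ge0_integralZr//; last first.
    apply/measurable_EFinP; apply: measurableT_comp => //.
    by apply: measurable_funM => //; apply: measurable_funB.
  (* Multiplying by the inverse of the normalizing constant gives back the plain moment bound. *)
  rewrite -(@lee_pmul2r _ (expR (t ^+ 2 * C ^+ 2 / 8))%:E) ?lte_fin ?expR_gt0//.
  rewrite -muleA -EFinM -expRD addNr expR0 mule1 mul1e.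
  have t_ge0 : 0 <= t by rewrite divr_ge0// ltW.
  exact: (hoeffding_mmt_gen C_gt0 t_ge0 (measurable_L y) (LC y) (meanE y)).
have : (0 <= \int[D]_z (phi z)%:E)%E.
  by apply: integral_ge0 => z _; rewrite lee_fin expR_ge0.
move: int_phi; case: (\int[D]_z _)%E => // r; rewrite !lee_fin => r1 r0.
by rewrite -EFin_expe lee_fin exprn_ile1.
Qed.

Variables (P : probability Y R) (Q : s.-tuple Z -> pprobability Y R).
Hypothesis mQ : measurable_fun setT Q.
Hypothesis QP : forall S, Q S `<< P.
Variable g : Y -> s.-tuple Z -> \bar R.
Hypothesis mg : measurable_fun setT (fun p : Y * s.-tuple Z => g p.1 p.2).
Hypothesis gE : forall S, {ae P, forall y, g y S =
  Radon_Nikodym (charge_of_finite_measure (Q S)) P y}.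
Variable delta : R.
Hypothesis delta_gt0 : 0 < delta.

(** Take logarithms and divide by [lambda > 0]. The equivalence covers every extended real [x],
    since the given version of the density may take any such value. *)
Lemma exp_excess_leP S y x : ((delta * exp_excess S y)%:E <= x)%E <->
  (true_cost L D y <= (empirical_cost L S y)%:E
   + (lambda^-1)%:E * (lne x + (ln (1 / delta))%:E)
   + (lambda * C ^+ 2 / (8 * s%:R))%:E)%E.
Proof.
have s_neq0 : s%:R != 0 :> R by rewrite pnatr_eq0 -lt0n.
have bound_gt0 : 0 < delta * exp_excess S y by rewrite mulr_gt0 ?expR_gt0.
(* For [x <= 0] the logarithm is minus infinity and both sides are false; for infinite [x] both are
   true. *)
rewrite meanE; have [x0|] := leP x 0%E.
  split=> [bx|]; first by have := le_trans bx x0; rewrite lee_fin leNgt bound_gt0.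
  by rewrite le0_lneNy//= gt0_muleNy ?lte_fin ?invr_gt0// addeNy addNye leeNy_eq.
case: x => [r||//]; last first.
  by rewrite leey/= gt0_muley ?lte_fin ?invr_gt0// leey.
rewrite lte_fin => r0.
rewrite lne_EFin// !lee_fin -ler_ln ?posrE// lnM ?posrE ?expR_gt0//.
rewrite /exp_excess expRK div1r lnV ?posrE//.
rewrite -(ler_pM2l lambda_gt0 (mean_cost y)).
set e := empirical_cost L S y; set m := mean_cost y.
have -> : lambda * (e + lambda^-1 * (ln r - ln delta)
                    + lambda * C ^+ 2 / (8 * s%:R)) =
  lambda * e + (ln r - ln delta) + lambda ^+ 2 * C ^+ 2 / (8 * s%:R).
  by field; rewrite s_neq0 gt_eqF.
by split=> ?; lra.
Qed.

(** The event of the final bound before taking logarithms, the form in which its measurability and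
    the comparison with the density are immediate. *)
Let good : set (s.-tuple Z * Y) :=
  [set p | ((delta * exp_excess p.1 p.2)%:E <= g p.2 p.1)%E].

Let swap : s.-tuple Z * Y -> Y * s.-tuple Z := fun p => (p.2, p.1).

Let measurable_swap : measurable_fun setT swap.
Proof. exact: measurable_fun_pair. Qed.

Let measurable_good : measurable good.
Proof.
rewrite -[good]setTI; apply: measurable_lee => //.
  apply/measurable_EFinP; apply: measurable_funM => //.
  exact: (measurableT_comp measurable_excess measurable_swap).
exact: (measurableT_comp mg measurable_swap).
Qed.

Let joint_law_good : ((1 - delta)%:E <= joint_law (iid_law D s) Q good)%E.
Proof.
rewrite joint_lawE//.
(* Bound on the failure probability given [S]. *)
pose a S : \bar R := (\int[P]_y (delta * exp_excess S y)%:E)%E.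
pose f (p : Y * s.-tuple Z) := (delta * exp_excess p.2 p.1)%:E.
have mf : measurable_fun setT f.
  by apply/measurable_EFinP; exact: measurable_funM.
have f0 p : (0 <= f p)%E by rewrite lee_fin mulr_ge0 ?expR_ge0// ltW.
have ma : measurable_fun setT a.
  exact: (@measurable_fun_fubini_tonelli_G _ _ _ _ _ P f).
have a0 S : (0 <= a S)%E by apply: integral_ge0 => y _; exact: (f0 (y, S)).
(* As [P] does not depend on [S], Tonelli allows integrating over [S] first, at fixed [y], where the
   excess has integral at most 1. *)
have int_a : (\int[iid_law D s]_S a S <= delta%:E)%E.
  rewrite -(fubini_tonelli (m1 := P) (m2 := iid_law D s) f)//.
  apply: (@le_trans _ _ (\int[P]_y (cst delta%:E y))%E); last first.
    by rewrite integral_cst//= probability_setT mule1.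
  apply: ge0_le_integral => //.
  - by move=> y _; apply: integral_ge0 => S _; exact: (f0 (y, S)).
  - exact: (@measurable_fun_fubini_tonelli_F _ _ _ _ _ _ f).
  - move=> y _; rewrite /f/=; under eq_integral do rewrite EFinM.
    rewrite ge0_integralZl//.
    + rewrite -[leRHS]mule1 lee_pmul2l ?lte_fin//; exact: integral_excess_le1.
    + apply/measurable_EFinP.
      exact: (measurableT_comp measurable_excess (measurable_pair1 y)).
    + by move=> S _; rewrite lee_fin expR_ge0.
    + by rewrite lee_fin ltW.
have mQgood : measurable_fun setT (fun S => Q S (xsection good S)).
  apply: (measurable_fun_xsection_finite_kernel (kprobability mQ)).
  by rewrite inE.
(* The unit mass of [Q S] splits over the section and its complement; on the complement [g] lies
   below [delta * exp_excess], so the change of measure applies. The additive form avoids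
   subtraction in the extended reals. *)
have Qgood S : (1 <= Q S (xsection good S) + a S)%E.
  rewrite -(@probability_setT _ _ _ (Q S)) -(setUv (xsection good S)).
  have mG := measurable_xsection S measurable_good.
  rewrite measureU//; [|exact: measurableC|exact: setICr].
  rewrite leeD2l// (Radon_Nikodym_le_integral (QP S) _ _ (gE S))//.
  - exact: (measurableT_comp mg (measurable_pair2 S)).
  - exact: (measurableT_comp mf (measurable_pair2 S)).
  - exact: measurableC.
  - by move=> y; exact: (f0 (y, S)).
  - by move=> y; rewrite /= /xsection/= inE => /negP; rewrite -ltNge => /ltW.
rewrite EFinB leeBlDr//.
(* Write 1 as the integral of the constant 1, so that [Qgood] can be integrated over [S]. *)
rewrite -(@probability_setT _ _ _ (iid_law D s)) -[leLHS]mul1e -integral_cst//.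
apply: (@le_trans _ _
  (\int[iid_law D s]_S (Q S (xsection good S) + a S))%E).
  by apply: ge0_le_integral => //; exact: emeasurable_funD.
by rewrite ge0_integralD// leeD2l.
Qed.

Lemma pac_bayes : ((1 - delta)%:E <= joint_law (iid_law D s) Q
  [set p | true_cost L D p.2 <= (empirical_cost L p.1 p.2)%:E
    + (lambda^-1)%:E * (lne (g p.2 p.1) + (ln (1 / delta))%:E)
    + (lambda * C ^+ 2 / (8 * s%:R))%:E])%E.
Proof.
rewrite (_ : mkset _ = good); first exact: joint_law_good.
by apply/seteqP; split=> -[S y] /exp_excess_leP.
Qed.

End pac_bayes.

(** * Specialization to the finite-horizon cost of the closed loop *)

Theorem theorem1 (R : realType) (n m d : nat)
  (X : set 'rV[R]_n) (U : set 'rV[R]_m)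
  (W : set 'rV[R]_n) (W0 : W !=set0)
  (Theta : set 'rV[R]_d) (Theta0 : Theta !=set0)
  (xbar : 'rV[R]_n)
  (f : forall t, t.-tuple 'rV[R]_n -> t.-tuple 'rV[R]_m -> 'rV[R]_n)
  (K : 'rV[R]_d -> forall t, t.+1.-tuple 'rV[R]_n -> 'rV[R]_m)
  (l : 'rV[R]_n -> 'rV[R]_m -> R)
  (s T : nat) (s_ge1 : (1 <= s)%N) (T_ge1 : (1 <= T)%N)
  (xbar_X : X xbar)
  (closed_loop_XU : forall (theta : borel_subset Theta0)
      (w : noise_seq W0 T) (t : 'I_T.+1),
      let xu := closed_loop f K xbar (point_of theta) (noise_path w) T in
      X (tnth xu.1 t) /\ U (tnth xu.2 t))
  (l_ge0 : forall x u, X x -> U u -> 0 <= l x u)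
  (l_pdiff : piecewise_differentiable (X `*` U)
      (fun z : 'rV[R]_n * 'rV[R]_m => l z.1 z.2))
  (D : 'I_T.+1 -> probability (borel_subset W0) R)
  (DT : probability (noise_seq W0 T) R)
  (DT_marginal : forall t A, measurable A ->
      DT [set w | A (tnth w t)] = D t A)
  (P : probability (borel_subset Theta0) R) :
  let L (theta : borel_subset Theta0) (w : noise_seq W0 T) :=
    finite_horizon_cost f K xbar l T (point_of theta) (noise_path w) in
  forall
  (L_measurable : measurable_fun setT
      (fun p : borel_subset Theta0 * noise_seq W0 T => L p.1 p.2))
  (C : R) (C_gt0 : 0 < C)
  (L_bounded : forall theta w, 0 <= L theta w < C)
  (lambda : R) (lambda_gt0 : 0 < lambda)
  (delta : R) (delta_01 : 0 < delta < 1)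
  (Q : dataset W0 T s -> pprobability (borel_subset Theta0) R)
  (Q_measurable : measurable_fun setT Q)
  (Q_ac : forall S, Q S `<< P)
  (dQdP : borel_subset Theta0 -> dataset W0 T s -> \bar R)
  (dQdP_measurable : measurable_fun setT
      (fun p : borel_subset Theta0 * dataset W0 T s => dQdP p.1 p.2))
  (dQdPE : forall S, {ae P, forall theta, dQdP theta S =
      Radon_Nikodym (charge_of_finite_measure (Q S)) P theta}),
  ((1 - delta)%:E <= joint_law (iid_law DT s) Q
     [set p | true_cost L DT p.2 <=
        (empirical_cost L p.1 p.2)%:E
        + (lambda^-1)%:E * (lne (dQdP p.2 p.1) + (ln (1 / delta))%:E)
        + (lambda * C ^+ 2 / (8 * s%:R))%:E])%E.
Proof.
move=> L L_measurable C C_gt0 L_bounded lambda lambda_gt0 delta /andP[delta_gt0 _].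
move=> Q Q_measurable Q_ac dQdP dQdP_measurable dQdPE.
(* The half-open range of the cost is weakened to the closed interval of the abstract bound. *)
apply: pac_bayes => // theta w.
by have /andP[-> /ltW] := L_bounded theta w.
Qed.
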